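(* Let $\sigma\in\mathcal{W}_{2,ac}(\mathbb{R}^n)$ and $\mu\in\mathcal{W}_2(\mathbb{R}^n)$. Then for any $P\in O(n)$, $$E\big((T_{\sigma,\mu;P})_\sharp\sigma\big)=E(\mu)\qquad\text{and}\qquad M_2\big((T_{\sigma,\mu;P})_\sharp\sigma\big)=M_2(\mu).$$
   Context: $\mathcal{W}_2(\mathbb{R}^n)$ is the set of Borel probability measures on $\mathbb{R}^n$ with finite second moment $M_2(\sigma)=\int\|x\|^2d\sigma(x)$, and $\mathcal{W}_{2,ac}(\mathbb{R}^n)$ the subset of those absolutely continuous with respect to Lebesgue measure. $E(\sigma)=\int x\,d\sigma(x)$. $\sharp$ denotes pushforward. For $\theta\in S^{n-1}$, $\sigma^\theta$ is the pushforward of $\sigma$ under $x\mapsto x\cdot\theta$. For one-dimensional measures $\alpha$ (absolutely continuous) and $\beta$, $T_\alpha^\beta=F_\beta^{-1}\circ F_\alpha$ is the optimal transport map ($F_\alpha$ the cumulative distribution function, $F_\beta^{-1}$ the quantile function), i.e. the $\alpha$-a.e. unique nondecreasing map pushing $\alpha$ to $\beta$. For $P=[\theta_1,\ldots,\theta_n]\in O(n)$ (orthogonal matrix with columns $\theta_i$) the matrix-slice matching map is $T_{\sigma,\mu;P}(x)=\sum_{i=1}^nT_{\sigma^{\theta_i}}^{\mu^{\theta_i}}(x\cdot\theta_i)\,\theta_i$. *)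

(* Defs.v *)
From HB Require Import structures.
From mathcomp Require Import all_boot all_order all_algebra.
From mathcomp Require Import all_classical all_reals all_analysis.
From mathcomp Require Import measurable_realfun.

Set Implicit Arguments.
Unset Strict Implicit.
Unset Printing Implicit Defensive.

Import Order.TTheory GRing.Theory Num.Theory.
Import numFieldNormedType.Exports.

Local Open Scope classical_set_scope.
Local Open Scope ring_scope.

(* R^n as column vectors with the Borel sigma-algebra. The topology on
   matrices is that of the sup norm `|x|, which is not the Euclidean norm. *)
Notation Rn R n := (g_sigma_algebraType (open : set_system 'cV[R]_n)).

Section Borel.
Context (R : realType).

Lemma continuous_measurable_Rn n (f : 'cV[R]_n -> R) :
  continuous f -> measurable_fun [set: Rn R n] (f : Rn R n -> R).
Proof.
move=> cf; apply: (measurability _ (RGenOpens.measurableE R)).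
move=> _ [_ [a [b ->] <-]]; rewrite setTI; apply: sub_sigma_algebra.
by move/continuousP : cf; apply; exact: interval_open.
Qed.

Lemma measurable_coord n (i : 'I_n) :
  measurable_fun [set: Rn R n] (fun x : Rn R n => (x : 'cV[R]_n) i 0).
Proof. by apply: continuous_measurable_Rn; exact: coord_continuous. Qed.

Lemma measurable_Rn d (T : measurableType d) n (f : T -> Rn R n) :
  (forall i, measurable_fun setT (fun t => (f t : 'cV[R]_n) i 0)) ->
  measurable_fun setT f.
Proof.
move=> mf; apply: (@measurability _ _ T (Rn R n) setT f (open : set_system 'cV[R]_n) erefl).
move=> _ [U oU <-]; rewrite setTI.
pose box (q : 'cV[rat]_n * nat) : set 'cV[R]_n :=
  [set y | forall i, `|ratr (q.1 i 0) - y i 0| < q.2.+1%:R^-1].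
rewrite [X in measurable X](_ : _ =
    \bigcup_(q in [set q | box q `<=` U]) (f @^-1` box q)); last first.
  apply/seteqP; split=> [t Uft|t [q qU] ftq]; last exact: qU.
  have /nbhs_ballP[e /= e0 eU] : nbhs (f t : 'cV[R]_n) U.
    exact: open_nbhs_nbhs.
  have [k ke] : exists k, k.+1%:R^-1 < e / 2.
    have [k _ kk] := near_infty_natSinv_lt (PosNum (divr_gt0 e0 (ltr0Sn R 1))).
    by exists k; exact: (kk k (leqnn k)).
  have qex i : exists q : rat, `|ratr q - (f t : 'cV[R]_n) i 0| < k.+1%:R^-1.
    have lt : (f t : 'cV[R]_n) i 0 < (f t : 'cV[R]_n) i 0 + k.+1%:R^-1.
      by rewrite ltrDl invr_gt0.
    have [q] := rat_in_itvoo lt; rewrite in_itv/= => /andP[q1 q2]; exists q.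
    by rewrite gtr0_norm ?subr_gt0// ltrBlDl.
  have [q qP] := choice qex.
  exists (\col_i q i, k); last by move=> i /=; rewrite mxE.
  move=> y /= yq; apply: eU; split=> // i j; rewrite ord1.
  have := yq i; rewrite mxE => {}yq.
  rewrite /ball/= -[X in `|X|](subrKA (ratr (q i))) (splitr e).
  rewrite (le_lt_trans (ler_normD _ _))// ltrD ?(lt_trans _ ke)//.
  by rewrite distrC.
rewrite bigcup_mkcond; apply: countable_bigcupT_measurable => // q.
case: ifPn => // _.
rewrite [X in measurable X](_ : _ = \bigcap_i
  ((fun t => (f t : 'cV[R]_n) i 0) @^-1` ball (ratr (q.1 i 0) : R) q.2.+1%:R^-1)).
  apply: fin_bigcap_measurable => // i _; rewrite -[X in measurable X]setTI.
  by apply: mf => //; apply: open_measurable; exact: ball_open.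
by apply/seteqP; split=> [t H i _|t H i]; [exact: H|exact: (H i)].
Qed.

End Borel.

Section Lebesgue.
Context (R : realType).

Definition consv n (p : R * Rn R n) : Rn R n.+1 :=
  \col_(i < n.+1) oapp (fun j => (p.2 : 'cV[R]_n) j 0) p.1 (unlift ord0 i).

Lemma measurable_consv n : measurable_fun setT (@consv n).
Proof.
apply: measurable_Rn => i; rewrite /consv.
under eq_fun do rewrite mxE; case: unliftP => [j _|_] /=.
  exact: (measurableT_comp (measurable_coord j) measurable_snd).
exact: measurable_fst.
Qed.

HB.instance Definition _ n :=
  isMeasurableFun.Build _ _ _ _ (@consv n) (@measurable_consv n).

Section step.
Context n (m : {sigma_finite_measure set (Rn R n) -> \bar R}).

Definition lebesgue_step : set (Rn R n.+1) -> \bar R :=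
  pushforward (lebesgue_measure \x m)%E (@consv n).

Let lebesgue_step0 : lebesgue_step set0 = 0%E.
Proof. by rewrite /lebesgue_step /pushforward preimage_set0 measure0. Qed.

Let lebesgue_step_ge0 A : (0 <= lebesgue_step A)%E.
Proof. by rewrite /lebesgue_step /pushforward measure_ge0. Qed.

Let lebesgue_step_sigma_additive : semi_sigma_additive lebesgue_step.
Proof.
have mcons A : measurable A -> measurable (@consv n @^-1` A).
  by move=> mA; rewrite -[X in measurable X]setTI; exact: measurable_consv.
move=> F mF tF mUF; rewrite /lebesgue_step /pushforward preimage_bigcup.
apply: measure_semi_sigma_additive => [k||]; first exact: mcons.
- apply/trivIsetP => i j _ _ ij; rewrite -preimage_setI.
  by move/trivIsetP : tF => /(_ _ _ I I ij) ->; rewrite preimage_set0.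
- by rewrite -preimage_bigcup; exact: mcons.
Qed.

HB.instance Definition _ := isMeasure.Build _ _ _ lebesgue_step
  lebesgue_step0 lebesgue_step_ge0 lebesgue_step_sigma_additive.

Lemma lebesgue_step_sigma_finite : sigma_finite setT lebesgue_step.
Proof.
have /sigma_finiteP[F [FT ndF Foo]] := sigma_finiteT (@lebesgue_measure R).
have /sigma_finiteP[G [GT ndG Goo]] := sigma_finiteT m.
pose hd (x : Rn R n.+1) : measurableTypeR R := (x : 'cV[R]_n.+1) ord0 0.
pose tl (x : Rn R n.+1) : Rn R n := \col_j (x : 'cV[R]_n.+1) (lift ord0 j) 0.
have hdK p : hd (consv p) = p.1 by rewrite /hd mxE unlift_none.
have tlK p : tl (consv p) = p.2.
  by apply/colP => j; rewrite /tl mxE mxE liftK.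
have mhd : measurable_fun setT hd by exact: measurable_coord.
have mtl : measurable_fun setT tl.
  apply: measurable_Rn => j; rewrite /tl.
  by under eq_fun do rewrite mxE; exact: measurable_coord.
exists (fun k => hd @^-1` F k `&` tl @^-1` G k).
  apply/seteqP; split=> // x _.
  have [k _ Fk] : (\bigcup_k F k) (hd x) by rewrite -FT.
  have [l _ Gl] : (\bigcup_l G l) (tl x) by rewrite -GT.
  exists (maxn k l) => //; split.
  - by apply: (subsetPset _ _ (ndF _ _ (leq_maxl k l))).
  - by apply: (subsetPset _ _ (ndG _ _ (leq_maxr k l))).
move=> k; have [mF Fk] := Foo k; have [mG Gk] := Goo k; split.
  by apply: measurableI; rewrite -[X in measurable X]setTI; [exact: mhd|exact: mtl].
rewrite /lebesgue_step /pushforward preimage_setI.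
rewrite (_ : _ `&` _ = F k `*` G k); last first.
  by apply/seteqP; split=> p /=; rewrite hdK tlK.
by rewrite product_measure1E// lte_mul_pinfty// ge0_fin_numE.
Qed.

HB.instance Definition _ :=
  Measure_isSigmaFinite.Build _ _ _ lebesgue_step lebesgue_step_sigma_finite.

End step.

(* n-dimensional Lebesgue measure as the n-fold product of the one-dimensional
   one; R^0 is a point, of mass 1. *)
Fixpoint lebesgue_Rn n : {sigma_finite_measure set (Rn R n) -> \bar R} :=
  match n with
  | 0 => \d_((0 : 'cV[R]_0) : Rn R 0)
  | n'.+1 => lebesgue_step (lebesgue_Rn n')
  end.

End Lebesgue.

Section Wasserstein.
Context (R : realType) (n : nat).
Implicit Types sigma mu : probability (Rn R n) R.

Definition dotv (x y : 'cV[R]_n) : R := \sum_(i < n) x i 0 * y i 0.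

Definition enorm (x : 'cV[R]_n) : R := Num.sqrt (dotv x x).

Definition barycenter sigma : 'cV[R]_n :=
  \col_i \int[sigma]_x (x : 'cV[R]_n) i 0.

Definition second_moment sigma : \bar R := \int[sigma]_x (enorm x ^+ 2)%:E.

Definition W2 sigma : Prop := (second_moment sigma < +oo)%E.

Definition W2ac sigma : Prop := W2 sigma /\ sigma `<< lebesgue_Rn R n.

Definition dirproj (theta : 'cV[R]_n) (x : Rn R n) : R := dotv x theta.

Lemma measurable_dirproj theta : measurable_fun setT (dirproj theta).
Proof.
apply: measurable_sum => i; apply: measurable_funM => //.
exact: measurable_coord.
Qed.

HB.instance Definition _ theta :=
  isMeasurableFun.Build _ _ _ _ (dirproj theta) (measurable_dirproj theta).

Definition slice sigma (theta : 'cV[R]_n) : probability R R :=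
  distribution sigma (dirproj theta).

End Wasserstein.

Section TransportMap.
Context (R : realType).
Implicit Types alpha beta : probability R R.

Definition cdf1 alpha (x : R) : \bar R := alpha `]-oo, x]%classic.

(* Generalized inverse of the cdf; it is real on ]0, 1[ and may be infinite at
   0 and 1. *)
Definition quantile beta (p : \bar R) : \bar R :=
  ereal_inf [set y%:E | y in [set y | (p <= cdf1 beta y)%E]].

(* [fine] sends the infinite values of the quantile to 0. These occur only where
   [cdf1 alpha] is 0 or 1, an alpha-null set when alpha is atomless. *)
Definition transport_map alpha beta (x : R) : R :=
  fine (quantile beta (cdf1 alpha x)).

Lemma quantile_cdf1_homo alpha beta :
  {homo (fun x => quantile beta (cdf1 alpha x)) : x y / x <= y >-> (x <= y)%E}.
Proof.
move=> x y xy; apply: ereal_inf_le_tmp => _ [z /= Fz <-].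
exists z => //; apply: le_trans Fz.
by apply: le_measure; rewrite ?inE//; exact: subset_itvl.
Qed.

Lemma measurable_transport_map alpha beta :
  measurable_fun setT (transport_map alpha beta).
Proof.
apply: (measurableT_comp (fine_measurable measurableT)) => /=.
apply: (measurability _ (ErealGenCInfty.measurableE R)).
move=> _ [_ [r ->] <-]; rewrite setTI; apply: is_interval_measurable.
move=> x y /= + _ z /andP[xz _]; rewrite !in_itv/= !andbT => rx.
by apply: (le_trans rx); exact: quantile_cdf1_homo.
Qed.

End TransportMap.

Section SliceMatching.
Context (R : realType) (n : nat).
Variables (sigma mu : probability (Rn R n) R) (P : 'M[R]_n).

Definition slice_matching (x : Rn R n) : Rn R n :=
  \sum_(i < n) transport_map (slice sigma (col i P)) (slice mu (col i P))
                 (dotv x (col i P)) *: col i P.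

Lemma measurable_slice_matching : measurable_fun setT slice_matching.
Proof.
apply: measurable_Rn => j; rewrite /slice_matching.
under eq_fun do rewrite summxE.
apply: measurable_sum => i; under eq_fun do rewrite mxE.
apply: measurable_funM => //.
exact: (measurableT_comp (measurable_transport_map _ _) (measurable_dirproj _)).
Qed.

HB.instance Definition _ :=
  isMeasurableFun.Build _ _ _ _ slice_matching measurable_slice_matching.

End SliceMatching.

(* Main.v *)
(* For each column theta_j of P the slice of sigma along theta_j is atomless,
   because hyperplanes are Lebesgue-null. Its cdf F is therefore uniformly
   distributed, and together with the Galois connection between quantile and cdf
   this makes F_beta^-1 o F push the slice of sigma to the slice beta of mu.
   Orthonormality gives (T x) . theta_j = T_j (x . theta_j), so T_# sigma and mu
   have equal slices along every theta_j. Both moments depend only on these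
   slices: x = \sum_j (x . theta_j) theta_j and |x|^2 = \sum_j (x . theta_j)^2. *)

Require Import Defs.
From HB Require Import structures.
From mathcomp Require Import all_boot all_order all_algebra.
From mathcomp Require Import all_classical all_reals all_analysis.
From mathcomp Require Import measurable_realfun.
Import Order.TTheory GRing.Theory Num.Theory.
Import numFieldNormedType.Exports.
Local Open Scope classical_set_scope.
Local Open Scope ring_scope.

(** * One-dimensional transport: cdf, quantile and pushforward *)

Section OneDimensional.
Context (R : realType).
Implicit Types (alpha beta : probability R R) (x y z : R).

Lemma cdf1_homo alpha : {homo cdf1 alpha : x y / x <= y >-> (x <= y)%E}.
Proof.
by move=> x y xy; apply: le_measure; rewrite ?inE//; exact: subset_itvl.
Qed.

Lemma cdf1_ge0 alpha x : (0 <= cdf1 alpha x)%E.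
Proof. exact: measure_ge0. Qed.

Lemma cdf1_le1 alpha x : (cdf1 alpha x <= 1)%E.
Proof. exact: probability_le1. Qed.

(** Right continuity of the cdf, phrased as a bound that passes to the limit along
    [y + n.+1%:R^-1]. *)
Lemma cdf1_right_lb alpha (p : \bar R) y :
  (forall z, y < z -> (p <= cdf1 alpha z)%E) -> (p <= cdf1 alpha y)%E.
Proof.
move=> pF; have yn n : y < y + n.+1%:R^-1 by rewrite ltrDl invr_gt0.
apply: (@cvge_to_ge _ \oo _ _ (fun n => cdf1 alpha (y + n.+1%:R^-1))); last first.
  by apply: nearW => n; exact: pF.
rewrite [in X in _ --> X]/cdf1 (itvNycEbigcap false).
apply: nonincreasing_cvg_mu => //.
- by rewrite -ge0_fin_numE// fin_num_measure.
- exact: bigcap_measurable.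
- move=> m n mn; apply/subsetPset; apply: subset_itvl.
  by rewrite bnd_simp lerD2l lef_pV2 ?posrE// ler_nat.
Qed.

(** Left continuity at a point that is not an atom: the cdf there is the mass of the open half-line,
    an increasing union of closed ones. *)
Lemma cdf1_left_ub alpha (p : \bar R) y : alpha [set y] = 0%E ->
  (forall z, z < y -> (cdf1 alpha z <= p)%E) -> (cdf1 alpha y <= p)%E.
Proof.
move=> y0 Fp; have yn n : y - n.+1%:R^-1 < y by rewrite gtrBl invr_gt0.
have -> : cdf1 alpha y = alpha `]-oo, y[%classic.
  by rewrite /cdf1 -(@setUitv1 _ _ -oo%O y true)// measureU0.
apply: (@cvge_to_le _ \oo _ _ (fun n => cdf1 alpha (y - n.+1%:R^-1))); last first.
  by apply: nearW => n; exact: Fp.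
have -> : `]-oo, y[%classic = \bigcup_n `]-oo, y - n.+1%:R^-1]%classic.
  apply/seteqP; split=> [x /=|x [n _]] /=; rewrite !in_itv/=.
    move=> /ltr_add_invr[k xk]; exists k => //=.
    by rewrite in_itv/= lerBrDr ltW.
  by move=> /le_lt_trans; exact.
apply: nondecreasing_cvg_mu => //; first exact: bigcup_measurable.
move=> m n mn; apply/subsetPset; apply: subset_itvl.
by rewrite bnd_simp lerD2l lerN2 lef_pV2 ?posrE// ler_nat.
Qed.

(** The identity as a random variable on [alpha]: its cdf is that of [alpha], which gives access to
    the limits of a cdf at both infinities. *)
Let id_rv : R -> R := idfun.

#[local] HB.instance Definition _ :=
  isMeasurableFun.Build _ _ _ _ id_rv (@measurable_id _ R setT).

Lemma cdf1_lt_ex alpha (p : \bar R) : (0 < p)%E -> exists x, (cdf1 alpha x < p)%E.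
Proof.
move=> p0; apply: contrapT => /forallNP pF.
move: p0; rewrite ltNge => /negP; apply.
apply: (cvge_to_ge (cvg_cdfNy0 (id_rv : {RV alpha >-> R}))).
by apply: nearW => x; rewrite leNgt; apply/negP/pF.
Qed.

Lemma cdf1_gt_ex alpha (p : \bar R) : (p < 1)%E -> exists x, (p < cdf1 alpha x)%E.
Proof.
move=> p1; apply: contrapT => /forallNP pF.
move: p1; rewrite ltNge => /negP; apply.
apply: (cvge_to_le (cvg_cdfy1 (id_rv : {RV alpha >-> R}))).
by apply: nearW => x; rewrite leNgt; apply/negP/pF.
Qed.

Lemma measurable_cdf1_le alpha (p : \bar R) :
  measurable [set x : R | (cdf1 alpha x <= p)%E].
Proof.
apply: is_interval_measurable => x y _ /= yp z /andP[_ zy].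
by apply: le_trans yp; exact: cdf1_homo.
Qed.

(** Apart from degenerate cases, the sublevel set is a half-line ending at its supremum, and
    continuity forces the cdf to equal [p] there. *)
Lemma cdf1_level alpha (p : \bar R) : (forall x, alpha [set x] = 0%E) ->
  (0 <= p <= 1)%E -> alpha [set x | (cdf1 alpha x <= p)%E] = p.
Proof.
move=> atomless /andP[p0]; rewrite le_eqVlt => /predU1P[->|p1].
  rewrite (_ : [set _ | _] = setT) ?probability_setT//.
  by apply/seteqP; split=> x //= _; exact: cdf1_le1.
set S := [set _ | _].
have [x1 px1] := cdf1_gt_ex alpha _ p1.
have ubS : ubound S x1.
  move=> x /= xp; rewrite leNgt; apply/negP => /ltW /(cdf1_homo alpha).
  by move=> /(lt_le_trans px1); rewrite ltNge xp.
(* An empty sublevel set forces [p] to be 0, since the cdf tends to 0 at minus infinity. *)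
have [S0|/set0P S0] := eqVneq S set0.
  rewrite S0 measure0; apply/eqP; rewrite eq_le p0/= leNgt.
  apply/negP => /(cdf1_lt_ex alpha)[x xp].
  by move: S0 => /seteqP[/(_ x) + _]; apply => /=; exact: ltW.
have supS : has_sup S by split => //; exists x1.
(* Points left of [sup S] lie below an element of [S], points right of it lie outside [S]; one-sided
   continuity turns this into the two bounds. *)
have Fs : cdf1 alpha (sup S) = p.
  apply/eqP; rewrite eq_le; apply/andP; split.
    apply: cdf1_left_ub => // z zs.
    have [e Se ze] := sup_gt S0 zs.
    by apply: le_trans Se; apply/cdf1_homo/ltW.
  apply: cdf1_right_lb => z sz; rewrite leNgt; apply/negP => zp.
  by move: sz; rewrite ltNge ub_le_sup//=; [exists x1|exact: ltW].
apply/eqP; rewrite eq_le; apply/andP; split.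
  by rewrite -[leRHS]Fs; apply: le_measure; rewrite ?inE//;
    [exact: measurable_cdf1_le|move=> x Sx/=; rewrite in_itv/= ub_le_sup//; exists x1].
rewrite -[leLHS]Fs; apply: le_measure; rewrite ?inE//; first exact: measurable_cdf1_le.
by move=> x /=; rewrite in_itv/= => /(cdf1_homo alpha); rewrite Fs.
Qed.
(** The Galois connection. From left to right, every [z > y] exceeds some point where the cdf has
    reached [p], and right continuity brings the bound down to [y]. *)
Lemma quantile_le beta (p : \bar R) y :
  (quantile beta p <= y%:E)%E = (p <= cdf1 beta y)%E.
Proof.
apply/idP/idP => [qy|py]; last by apply: ereal_inf_lbound; exists y.
apply: cdf1_right_lb => z yz.
have /ereal_inf_lt[_ [t /= pt <-]] : (quantile beta p < z%:E)%E.
  by apply: le_lt_trans qy _; rewrite lte_fin.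
by rewrite lte_fin => /ltW/(cdf1_homo beta); exact: le_trans.
Qed.

Lemma quantile_fin_num beta (p : \bar R) : (0 < p < 1)%E ->
  quantile beta p \is a fin_num.
Proof.
move=> /andP[p0 p1].
have [x xp] := cdf1_lt_ex beta _ p0.
have [y py] := cdf1_gt_ex beta _ p1.
rewrite fin_numElt; apply/andP; split.
  by rewrite (@lt_trans _ _ x%:E) ?ltNyr// ltNge quantile_le -ltNge.
by rewrite (@le_lt_trans _ _ y%:E) ?ltry// quantile_le ltW.
Qed.

Lemma transport_map_le alpha beta x y : (0 < cdf1 alpha x < 1)%E ->
  (transport_map alpha beta x <= y) = (cdf1 alpha x <= cdf1 beta y)%E.
Proof.
by move=> Fx; rewrite -quantile_le -lee_fin fineK// quantile_fin_num.
Qed.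

(** Discards the points where the quantile may be infinite and [fine] would return its default
    value. *)
Lemma cdf1_extreme_null alpha : (forall x, alpha [set x] = 0%E) ->
  alpha (~` [set x | (0 < cdf1 alpha x < 1)%E]) = 0%E.
Proof.
move=> atomless; set N := ~` _.
have m0 : measurable [set x | (cdf1 alpha x <= 0)%E] by exact: measurable_cdf1_le.
have m1 : measurable [set x | (1 <= cdf1 alpha x)%E].
  apply: is_interval_measurable => x y /= x1 _ z /andP[xz _].
  by apply: (le_trans x1); exact: cdf1_homo.
have -> : N = [set x | (1 <= cdf1 alpha x)%E] `|` [set x | (cdf1 alpha x <= 0)%E].
  apply/seteqP; split=> [x /= /negP|x /= [x1|x0]].
  - by rewrite negb_and -!leNgt => /orP[]; [right|left].
  - by apply/negP; rewrite negb_and -!leNgt x1 orbT.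
  - by apply/negP; rewrite negb_and -!leNgt x0.
rewrite measureU0//; last by apply: cdf1_level; rewrite // lexx lee01.
apply/eqP; rewrite eq_le measure_ge0 andbT.
(* For [e < 1], the points where the cdf is 1 lie above the level [1 - e], a set of mass exactly [e]
   by [cdf1_level]; the case [1 <= e] is separate because that level must be nonnegative. *)
apply/lee_addgt0Pr => e e0; rewrite add0e.
have [e1|e1] := leP 1 e.
  by rewrite (@le_trans _ _ 1%:E) ?probability_le1.
have -> : e%:E = alpha (~` [set x | (cdf1 alpha x <= (1 - e)%:E)%E]).
  rewrite probability_setC; last exact: measurable_cdf1_le.
  rewrite (cdf1_level alpha (1 - e)%:E atomless); first by rewrite -EFinB subKr.
  by rewrite !lee_fin subr_ge0 ltW//= gerBl ltW.
apply: le_measure; rewrite ?inE//; first by apply: measurableC; exact: measurable_cdf1_le.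
move=> x /= x1; apply/negP; rewrite -ltNge; apply: lt_le_trans x1.
by rewrite lte_fin gtrBl.
Qed.

(** Closed left half-lines form a class stable under intersection, generate the Borel sets through
    differences, and exhaust the line. *)
Lemma cdf1_inj alpha beta : cdf1 alpha =1 cdf1 beta ->
  forall A, measurable A -> alpha A = beta A.
Proof.
move=> ab A mA.
pose G : set_system R := [set B | exists x, B = `]-oo, x]%classic].
apply: (measure_unique G (fun n => `]-oo, n%:R]%classic)) => //.
- rewrite eqEsubset; split=> B; apply: smallest_sub.
  + exact: smallest_sigma_algebra.
  + move=> _ [[a b] _ <-] /=.
    have -> : `]a, b]%classic = `]-oo, b] `\` `]-oo, a] :> set R.
      by rewrite -[RHS]setCK setCD setCitvl setUC -[LHS]setCK setCitv.
    by apply: (@measurableD _ (g_sigma_algebraType G));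
      apply: sub_sigma_algebra; eexists.
  + exact: sigma_algebra_measurable.
  + by move=> _ [x ->]; exact: measurable_itv.
- move=> _ _ [x ->] [y ->]; exists (Num.min x y).
  by apply/seteqP; split=> z /=; rewrite !in_itv/= le_min => /andP.
- by move=> n; exists n%:R.
- apply/seteqP; split=> // x _; exists (Num.truncn `|x|).+1 => //=.
  rewrite in_itv/= (le_trans (ler_norm x))// ltW//.
  by rewrite truncnS_gt.
- by move=> _ [x ->]; exact: ab.
- by move=> n; rewrite -ge0_fin_numE// fin_num_measure.
Qed.

Lemma transport_map_push alpha beta : (forall x, alpha [set x] = 0%E) ->
  forall A, measurable A -> alpha (transport_map alpha beta @^-1` A) = beta A.
Proof.
move=> atomless.
pose T := transport_map alpha beta.
have mT : measurable_fun setT T by exact: measurable_transport_map.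
pose TT : {mfun R >-> R} := HB.pack T (isMeasurableFun.Build _ _ _ _ T mT).
move=> A mA; change (distribution alpha TT A = beta A).
apply: cdf1_inj => // y.
set N := ~` [set x | (0 < cdf1 alpha x < 1)%E].
have N0 : alpha N = 0%E by exact: cdf1_extreme_null.
have mN : measurable N.
  apply: measurableC; apply: is_interval_measurable.
  move=> x z /= /andP[x0 _] /andP[_ z1] t /andP[xt tz].
  by rewrite (lt_le_trans x0) ?(le_lt_trans _ z1) ?cdf1_homo.
have mS := measurable_cdf1_le alpha (cdf1 beta y).
have mTy : measurable (T @^-1` `]-oo, y]%classic) by exact: (measurable_funPTI TT).
rewrite -[RHS](cdf1_level alpha _ atomless); last by rewrite cdf1_ge0 cdf1_le1.
(* Adding the null set [N] to both sides leaves an equality of sets to check only where the quantile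
   is finite. *)
rewrite -[RHS](measureU0 mS mN N0) -[LHS](measureU0 mTy mN N0); congr (alpha _).
have TS x : ~ N x -> (T @^-1` `]-oo, y]%classic) x <-> (cdf1 alpha x <= cdf1 beta y)%E.
  by move=> /contrapT Fx; rewrite /= in_itv/= transport_map_le.
apply/seteqP; split=> x [Hx|]; [|by right|  |by right];
  have [Nx|Nx] := pselect (N x); [by right| |by right|]; left.
- exact/TS.
- exact/TS.
Qed.

End OneDimensional.

(** * Hyperplanes are Lebesgue-null *)

Section Hyperplanes.
Context (R : realType).

Lemma dotv_consv n (p : R * Rn R n) (theta : 'cV[R]_n.+1) :
  dotv (consv p) theta =
  p.1 * theta ord0 0 + dotv p.2 (\col_j theta (lift ord0 j) 0).
Proof.
rewrite /dotv big_ord_recl mxE unlift_none; congr (_ + _).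
by apply: eq_bigr => j _; rewrite !mxE liftK.
Qed.

(** Induction on the dimension, splitting off the first coordinate; in dimension 0 no vector is
    nonzero. *)
Lemma lebesgue_Rn_hyperplane n (theta : 'cV[R]_n) (c : R) : theta != 0 ->
  lebesgue_Rn R n [set x | dotv x theta = c] = 0%E.
Proof.
elim: n theta c => [|n IHn] theta c theta0; first by rewrite flatmx0 eqxx in theta0.
pose theta' : 'cV[R]_n := \col_j theta (lift ord0 j) 0.
change ((lebesgue_measure \x lebesgue_Rn R n)%E
  [set p : R * Rn R n | dotv (consv p) theta = c] = 0%E).
under eq_set do rewrite dotv_consv -/theta'.
(* If only the first entry of [theta] survives, the hyperplane is a product with a one-point first
   factor. *)
have [t'0|t'0] := eqVneq theta' 0.
  have t00 : theta ord0 0 != 0.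
    apply: contra_neq theta0 => t00; apply/colP => i; rewrite mxE.
    case: (unliftP ord0 i) => [j ->|-> //].
    by move/colP/(_ j) : t'0; rewrite !mxE.
  rewrite (_ : [set _ | _] = [set c / theta ord0 0] `*` setT).
    rewrite product_measure1E//.
    by rewrite [X in (X * _)%E](lebesgue_measure_set1 (c / theta ord0 0)) mul0e.
  have dot0 y : dotv y theta' = 0.
    by rewrite /dotv big1// => i _; rewrite t'0 mxE mulr0.
  apply/seteqP; split=> [[x y]|[x y] [/= -> _]] /=; rewrite dot0 addr0.
    by move=> <-; rewrite mulfK.
  by rewrite divfK.
(* The product measure integrates the masses of sections, and each section is a hyperplane with
   normal [theta'], null by induction. *)
apply: integral0_eq => x _ /=.
rewrite (_ : xsection _ _ = [set y | dotv y theta' = c - x * theta ord0 0]) ?IHn//.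
apply/seteqP; split=> y; rewrite /xsection/= inE/=.
  by move=> <-; rewrite addrAC subrr add0r.
by move=> ->; rewrite addrC subrK.
Qed.

Lemma slice_atomless n (sigma : probability (Rn R n) R) (theta : 'cV[R]_n) (c : R) :
  sigma `<< lebesgue_Rn R n -> theta != 0 -> slice sigma theta [set c] = 0%E.
Proof.
move=> ac theta0.
have mH : measurable [set x : Rn R n | dotv x theta = c].
  by exact: (measurable_funPTI (dirproj theta) (measurable_set1 c)).
by move/null_content_dominatesP : ac; apply => //; exact: lebesgue_Rn_hyperplane.
Qed.

End Hyperplanes.

(** * Moments and the matching map in terms of slices *)

Section Slices.
Context (R : realType) (n : nat).
Implicit Types (rho sigma mu : probability (Rn R n) R) (P : 'M[R]_n).

Lemma enorm_sqr (x : 'cV[R]_n) : enorm x ^+ 2 = dotv x x.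
Proof. by rewrite sqr_sqrtr// sumr_ge0// => i _; rewrite -expr2 sqr_ge0. Qed.

Lemma dotv_col (x : 'cV[R]_n) P j : dotv x (col j P) = (P^T *m x) j 0.
Proof. by rewrite mxE; apply: eq_bigr => i _; rewrite !mxE mulrC. Qed.

(** For a square matrix the left inverse [P^T] is also a right inverse, so [x = P *m (P^T *m x)]. *)
Lemma coord_dotv_col P (x : 'cV[R]_n) i : P^T *m P = 1%:M ->
  x i 0 = \sum_j P i j * dotv x (col j P).
Proof.
move=> /mulmx1C PP; rewrite -[in LHS](mul1mx x) -PP -mulmxA mxE.
by apply: eq_bigr => j _; rewrite dotv_col.
Qed.

Lemma enorm_sqr_dotv_col P (x : 'cV[R]_n) : P^T *m P = 1%:M ->
  enorm x ^+ 2 = \sum_j dotv x (col j P) ^+ 2.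
Proof.
move=> /mulmx1C PP; rewrite enorm_sqr.
transitivity ((x^T *m x) 0 0).
  by rewrite mxE; apply: eq_bigr => i _; rewrite mxE.
rewrite -[X in _ *m X](mul1mx x) -PP -mulmxA mulmxA -[X in X *m _]trmxK.
rewrite trmx_mul trmxK mxE; apply: eq_bigr => j _.
by rewrite dotv_col expr2 mxE.
Qed.

Lemma dotv_slice_matching sigma mu P (x : Rn R n) j : P^T *m P = 1%:M ->
  dotv (slice_matching sigma mu P x) (col j P) =
  transport_map (slice sigma (col j P)) (slice mu (col j P)) (dotv x (col j P)).
Proof.
move=> PP; pose t := \col_i transport_map (slice sigma (col i P))
  (slice mu (col i P)) (dotv x (col i P)).
(* In the basis of columns the map acts coordinatewise: it is [P] applied to [t], and [P^T] then
   cancels [P]. *)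
have -> : slice_matching sigma mu P x = P *m t.
  apply/colP => k; rewrite summxE mxE; apply: eq_bigr => i _.
  by rewrite !mxE mulrC.
by rewrite dotv_col mulmxA PP mul1mx mxE.
Qed.

Lemma slice_slice_matching sigma mu P j : sigma `<< lebesgue_Rn R n ->
  P^T *m P = 1%:M -> forall A, measurable A ->
  slice (distribution sigma (slice_matching sigma mu P)) (col j P) A =
  slice mu (col j P) A.
Proof.
move=> ac PP A mA.
have Pj0 : col j P != 0.
  apply/eqP => Pj; have /matrixP/(_ j j) := PP.
  rewrite mxE big1 ?mxE ?eqxx; first by move/eqP; rewrite eq_sym oner_eq0.
  by move=> k _; move/colP/(_ k) : Pj; rewrite !mxE => ->; rewrite mulr0.
rewrite -(transport_map_push R (slice sigma (col j P)) (slice mu (col j P)))//.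
  congr (sigma _); apply/seteqP; split=> x /=;
    by rewrite /dirproj dotv_slice_matching.
by move=> c; exact: slice_atomless.
Qed.

(** Nonnegativity lets sum and integral commute in the extended reals, so no finiteness of the
    moment is assumed. *)
Lemma second_moment_slice rho P : P^T *m P = 1%:M ->
  second_moment rho = (\sum_j \int[slice rho (col j P)]_t (t ^+ 2)%:E)%E.
Proof.
move=> PP; rewrite /second_moment.
under eq_integral do rewrite (enorm_sqr_dotv_col _ _ PP) -sumEFin.
rewrite ge0_integral_sum//=.
- apply: eq_bigr => j _; rewrite ge0_integral_distribution//.
  + exact/measurable_EFinP/measurable_funX.
  + by move=> t; rewrite lee_fin sqr_ge0.
- move=> j; apply/measurable_EFinP/measurable_funX; exact: measurable_dirproj.
- by move=> j x _; rewrite lee_fin sqr_ge0.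
Qed.

(** Projections are signed, so splitting the barycenter into slice integrals requires their
    integrability. *)
Lemma W2_integrable_dirproj rho theta : W2 rho ->
  rho.-integrable setT (EFin \o dirproj theta).
Proof.
move=> rho2; rewrite /dirproj /dotv /comp; under eq_fun do rewrite -sumEFin.
apply: integrable_sum => // i _.
under eq_fun do rewrite mulrC EFinM; apply: integrableZl => //.
have mcoord k : measurable_fun setT (fun x : Rn R n => (x : 'cV[R]_n) k 0).
  exact: measurable_coord.
have int2 : rho.-integrable setT (EFin \o (fun x => enorm x ^+ 2)).
  apply/integrableP; split; last first.
    by under eq_integral do rewrite /= ger0_norm ?sqr_ge0//.
  apply/measurable_EFinP; rewrite (_ : (fun _ => _) = fun x => dotv x x).
    by apply: measurable_sum => k; exact: measurable_funM.
  by apply/funext => x; exact: enorm_sqr.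
have int1 := finite_measure_integrable_cst rho 1 measurableT.
(* Each coordinate is dominated by [1 + enorm x ^+ 2], integrable because [rho] has finite mass and
   finite second moment. *)
apply: (le_integrable measurableT _ _ (integrableD measurableT int1 int2)).
  exact/measurable_EFinP.
move=> x _ /=; rewrite lee_fin [leRHS]ger0_norm ?addr_ge0 ?sqr_ge0//.
have xi : `|(x : 'cV[R]_n) i 0| ^+ 2 <= enorm x ^+ 2.
  rewrite enorm_sqr /dotv (bigD1 i)//= real_normK ?num_real// expr2 lerDl.
  by apply: sumr_ge0 => k _; rewrite -expr2 sqr_ge0.
apply: le_trans (_ : 1 + `|(x : 'cV[R]_n) i 0| ^+ 2 <= _); last by rewrite lerD2l.
have [x1|x1] := leP `|(x : 'cV[R]_n) i 0| 1.
  by rewrite (le_trans x1)// lerDl sqr_ge0.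
by rewrite ler_wpDl// expr2 ler_peMl// ltW.
Qed.

Lemma barycenter_slice rho P : P^T *m P = 1%:M -> W2 rho ->
  barycenter rho =
  \col_i \sum_j P i j * \int[slice rho (col j P)]_t t.
Proof.
move=> PP rho2; apply/colP => i; rewrite !mxE.
under eq_Rintegral do rewrite (coord_dotv_col _ _ _ PP).
rewrite /Rintegral; under eq_integral do rewrite -sumEFin.
have intP j : rho.-integrable setT (fun x => (P i j * dotv x (col j P))%:E).
  under eq_fun do rewrite EFinM.
  by apply: integrableZl => //; exact: W2_integrable_dirproj.
rewrite integral_sum// -sum_fine; last by move=> j _; exact: integrable_fin_num.
apply: eq_bigr => j _.
transitivity (P i j * \int[rho]_x dirproj (col j P) x).
  by rewrite -RintegralZl//; exact: W2_integrable_dirproj.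
congr (_ * fine _); rewrite integral_distribution//.
exact: W2_integrable_dirproj.
Qed.

End Slices.

Theorem proposition3p6 (R : realType) (n : nat)
    (sigma mu : probability (Rn R n) R)
    (hsigma : W2ac sigma) (hmu : W2 mu)
    (P : 'M[R]_n) (hP : P^T *m P = 1%:M) :
  let nu : probability (Rn R n) R :=
    distribution sigma (slice_matching sigma mu P) in
  barycenter nu = barycenter mu /\ second_moment nu = second_moment mu.
Proof.
move=> nu; have [_ ac] := hsigma.
have slice_nu j A : measurable A -> slice nu (col j P) A = slice mu (col j P) A.
  exact: slice_slice_matching.
have M2 : second_moment nu = second_moment mu.
  rewrite !(second_moment_slice _ _ _ _ hP); apply: eq_bigr => j _.
  by apply: eq_measure_integral => A mA _; exact: slice_nu.
(* The equality of second moments comes first because it supplies [W2 nu], required for the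
   barycenter of [nu]. *)
split=> //; rewrite !(barycenter_slice _ _ _ _ hP)//; last by rewrite /W2 M2.
apply/colP => i; rewrite !mxE; apply: eq_bigr => j _; congr (_ * fine _).
by apply: eq_measure_integral => A mA _; exact: slice_nu.
Qed.
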